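(* In the two-scenario robust investment problem described in the context, there exist a constant $\theta^*\in[0,1]$ and an admissible control $u^*\in\mathcal U$ such that, writing $y^*_\gamma(0)=y_\gamma(0;u^* )$, $\Theta^*=\begin{pmatrix}\theta^*&0\\0&1-\theta^*\end{pmatrix}$ and $\mathbb G^{\theta^*}(k)=\theta^*\mathbb G_1(k)+(1-\theta^* )\mathbb G_2(k)$, $$J(u^* )=\sup_{\theta\in[0,1]}\big(\theta y^*_1(0)+(1-\theta)y^*_2(0)\big)=\max(y^*_1(0),y^*_2(0))=\theta^*y^*_1(0)+(1-\theta^* )y^*_2(0)$$ and, for every $k\in\mathcal T$, $$\mathbb A(k)\Theta^*P(k)+\sum_{j=1}^d\beta^j(k)\Theta^*Q^j(k)+\mathbb G^{\theta^*}(k)\big(u^*(k)-\Psi(k)\big)=0 .$$ Moreover, the control $u^*$ defined, with this $\theta^*$, by $$u^*(k)=\Psi(k)+(\mathbb G^{\theta^*}(k))^{-1}\mathbb A(k)\Theta^*\mathbb H\prod_{i=k+1}^{N-1}(1+e(i)),\qquad k\in\mathcal T,$$ (with the empty product equal to $1$) is an optimal portfolio for the robust investment problem, i.e. it minimizes $J$ over $\mathcal U$.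
   Context: $N>0$ is a fixed integer and $\mathcal T=\{0,\dots,N-1\}$. On a complete probability space $(\Omega,\mathcal F,\mathbb P)$, $B(1),\dots,B(N)$ are independent $\mathbb R^d$-valued random variables with components $B^j(k)$ and $\mathbb E[|B(k)|^p]\le C(p)<\infty$ for some $p\ge2$; $\mathcal F_0=\{\emptyset,\Omega\}$, $\mathcal F_k=\sigma(B(1),\dots,B(k))$; and $\mathbb E[B^j(k+1)\mid\mathcal F_k]=0$, $\mathbb E[B^j(k+1)^2\mid\mathcal F_k]=1$ for all $j$ and $k\in\mathcal T$. $\mathcal U$ is the set of $u=\{u(k)\}_{k\in\mathcal T}$ with $u(k)$ an $\mathcal F_k$-measurable $\mathbb R^m$-valued random variable and $\mathbb E[\sum_{k=0}^{N-1}|u(k)|^q]<\infty$ with some (fixed) $q>2$. Market conditions: $\gamma\in\Gamma=\{1,2\}$. The interest rate $e(k)>0$ is bounded and deterministic. For each $\gamma$, $\mu_\gamma(k)$ and $\beta^j_\gamma(k)$, $1\le j\le d$, are bounded $\mathcal F_k$-measurable $\mathbb R^m$-valued random variables (stock appreciation rates and volatilities); $\Psi(k)$ is a bounded $\mathcal F_k$-measurable $\mathbb R^m$-valued random variable (benchmark); $\mathbb G_\gamma(k)$ is a bounded $\mathcal F_k$-measurable real random variable with $\mathbb G_\gamma(k)\gg0$, i.e. bounded below by a positive constant; $\mathbb H_\gamma>0$ is a constant. Put $1_m=(1,\dots,1)^\top$ and $\mathbb A_\gamma(k)=\mu_\gamma(k)-e(k)1_m$. For a portfolio $u\in\mathcal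 U$ the wealth satisfies $x_\gamma(0)=x(0)>0$ and, for $k\in\mathcal T$, $$x_\gamma(k+1)=(1+e(k))x_\gamma(k)+\mathbb A_\gamma(k)^\top u(k)+\sum_{j=1}^d\beta^j_\gamma(k)^\top u(k)\,B^j(k+1).$$ Let $$y_\gamma(0;u)=\mathbb E\Big[\tfrac12\sum_{k=0}^{N-1}\mathbb G_\gamma(k)|u(k)-\Psi(k)|^2-\mathbb H_\gamma x_\gamma(N)\Big].$$ The set of priors is $\Lambda=\{\lambda^\theta:\theta\in[0,1]\}$ with $\lambda^\theta(\{1\})=\theta$, $\lambda^\theta(\{2\})=1-\theta$, and the cost to be minimized over $\mathcal U$ is $J(u)=\sup_{\lambda\in\Lambda}\int_\Gamma y_\gamma(0;u)\lambda(d\gamma)=\sup_{\theta\in[0,1]}(\theta y_1(0;u)+(1-\theta)y_2(0;u))$. Matrix notation: $\mathbb A(k)=[\mathbb A_1(k)\ \mathbb A_2(k)]\in\mathbb R^{m\times2}$, $\beta^j(k)=[\beta^j_1(k)\ \beta^j_2(k)]\in\mathbb R^{m\times2}$, $\mathbb H=(\mathbb H_1,\mathbb H_2)^\top$. The adjoint processes $P(k)=(P_1(k),P_2(k))^\top\in\mathbb R^2$ and $Q(k)\in\mathbb R^{2\times d}$, with columns $Q^j(k)=(Q^j_1(k),Q^j_2(k))^\top$, are defined by $P(N-1)=\mathbb E[-\mathbb H\mid\mathcal F_{N-1}]$, $Q(N-1)=\mathbb E[-\mathbb H B(N)^\top\mid\mathcal F_{N-1}]$ and, for $k=0,\dots,N-2$,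 $$P(k)=\mathbb E[(1+e(k+1))P(k+1)\mid\mathcal F_k],\qquad Q(k)=\mathbb E[(1+e(k+1))P(k+1)B(k+1)^\top\mid\mathcal F_k].$$ *)

(* Defs.v *)
From HB Require Import structures.
From mathcomp Require Import all_boot all_order all_algebra.
From mathcomp Require Import all_classical all_reals all_analysis.
Set Implicit Arguments.
Unset Strict Implicit.
Unset Printing Implicit Defensive.
Import Order.TTheory GRing.Theory Num.Theory.
Import numFieldNormedType.Exports.
Local Open Scope classical_set_scope.
Local Open Scope ring_scope.

Definition dot (R : realType) (n : nat) (x y : 'cV[R]_n) : R :=
  \sum_i x i ord0 * y i ord0.

(* The Euclidean norm; the library's norm on matrices is the sup norm. *)
Definition enorm (R : realType) (n : nat) (x : 'cV[R]_n) : R :=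
  Num.sqrt (dot x x).

(* A generating family of sigma(X): inverse images of Borel sets of R by the
   entries of X.  It generates sigma(X) because the Borel sigma-algebra of
   R^(a x b) is the product one. *)
Definition mx_events (dT : measure_display) (T : measurableType dT)
    (R : realType) (a b : nat) (X : T -> 'M[R]_(a, b)) : set (set T) :=
  \bigcup_(ij in [set: 'I_a * 'I_b])
    preimage_set_system setT (fun w => X w ij.1 ij.2) measurable.

Definition mx_measurable (dT : measure_display) (T : measurableType dT)
    (R : realType) (a b : nat) (X : T -> 'M[R]_(a, b)) : Prop :=
  forall i j, measurable_fun [set: T] (fun w => X w i j).

(* Here and below [G] is a generating family: measurability is with respect to
   <<s G >>. *)
Definition measurable_wrt (dT : measure_display) (T : measurableType dT)
    (R : realType) (G : set (set T)) (X : T -> R) : Prop :=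
  measurable_fun [set: g_sigma_algebraType G] (X : g_sigma_algebraType G -> R).

Definition mx_measurable_wrt (dT : measure_display) (T : measurableType dT)
    (R : realType) (G : set (set T)) (a b : nat) (X : T -> 'M[R]_(a, b)) :
    Prop :=
  forall i j, measurable_wrt G (fun w => X w i j).

(* Generating family of F_k = sigma(B(1), ..., B(k)); it is empty for k = 0, so
   that F_0 is the trivial sigma-algebra. *)
Definition filtration (dT : measure_display) (T : measurableType dT)
    (R : realType) (d : nat) (B : nat -> T -> 'cV[R]_d) (k : nat) :
    set (set T) :=
  \bigcup_(i in [set i | (0 < i <= k)%N]) mx_events (B i).

Definition independent_vectors (dT : measure_display) (T : measurableType dT)
    (R : realType) (P : probability T R) (d N : nat)
    (B : nat -> T -> 'cV[R]_d) : Prop :=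
  forall (J : {set 'I_N}) (A : 'I_N -> set T),
    (forall k, k \in J -> <<s mx_events (B k.+1) >> (A k)) ->
    P (\bigcap_(k in [set` J]) A k) = (\prod_(k in J) P (A k))%E.

(* [Y] is a version of E[X | sigma(G)]. *)
Definition cond_exp (dT : measure_display) (T : measurableType dT)
    (R : realType) (P : probability T R) (G : set (set T)) (X Y : T -> R) :
    Prop :=
  [/\ P.-integrable setT (EFin \o X),
      measurable_wrt G Y,
      P.-integrable setT (EFin \o Y) &
      forall A, <<s G >> A ->
        (\int[P]_(w in A) (Y w)%:E = \int[P]_(w in A) (X w)%:E)%E].

Definition mx_cond_exp (dT : measure_display) (T : measurableType dT)
    (R : realType) (P : probability T R) (G : set (set T)) (a b : nat)
    (X Y : T -> 'M[R]_(a, b)) : Prop :=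
  forall i j, cond_exp P G (fun w => X w i j) (fun w => Y w i j).

(* Boundedness of random variables is understood almost surely. *)
Definition bounded_rv (dT : measure_display) (T : measurableType dT)
    (R : realType) (P : probability T R) (X : T -> R) : Prop :=
  exists M : R, {ae P, forall w, `|X w| <= M}.

Definition bounded_rvec (dT : measure_display) (T : measurableType dT)
    (R : realType) (P : probability T R) (n : nat) (X : T -> 'cV[R]_n) : Prop :=
  bounded_rv P (fun w => enorm (X w)).

Definition scenario : Type := 'I_2.

HB.instance Definition _ := Finite.on scenario.
HB.instance Definition _ := isPointed.Build scenario (ord0 : 'I_2).
HB.instance Definition _ := @isMeasurable.Build default_measure_display
  scenario discrete_measurable discrete_measurable0
  discrete_measurableC discrete_measurableU.

Definition gamma1 : scenario := (ord0 : 'I_2).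
Definition gamma2 : scenario := (ord_max : 'I_2).

Definition is_prior (R : realType) (theta : R) (l : probability scenario R) :
    Prop :=
  l [set gamma1] = theta%:E /\ l [set gamma2] = (1 - theta)%:E.

Definition priors (R : realType) : set (probability scenario R) :=
  [set l | exists theta : R, 0 <= theta <= 1 /\ is_prior theta l].

Definition mix (R : realType) (theta : R) (y : scenario -> \bar R) : \bar R :=
  (theta%:E * y gamma1 + (1 - theta)%:E * y gamma2)%E.

(* Time-indexed data are functions on [nat]; only the times of the model
   (k < N, and 0 < k <= N for the noise [B]) are ever used. *)

Record market (dT : measure_display) (T : measurableType dT) (R : realType)
    (m d : nat) := Market {
  rate : nat -> R;                                (* e *)
  appreciation : scenario -> nat -> T -> 'cV[R]_m;       (* mu *)
  volatility : scenario -> 'I_d -> nat -> T -> 'cV[R]_m; (* beta *)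
  benchmark : nat -> T -> 'cV[R]_m;               (* Psi *)
  weight : scenario -> nat -> T -> R;             (* G *)
  reward : scenario -> R;                         (* H *)
  wealth0 : R                                     (* x(0) *)
}.

(* A_gamma(k) *)
Definition excess (dT : measure_display) (T : measurableType dT)
    (R : realType) (m d : nat) (M : market T R m d) (g : scenario) (k : nat)
    (w : T) : 'cV[R]_m :=
  appreciation M g k w - rate M k *: const_mx 1.

Fixpoint wealth (dT : measure_display) (T : measurableType dT) (R : realType)
    (m d : nat) (M : market T R m d) (B : nat -> T -> 'cV[R]_d)
    (u : nat -> T -> 'cV[R]_m) (g : scenario) (k : nat) (w : T) : R :=
  if k is k'.+1 then
    (1 + rate M k') * wealth M B u g k' w + dot (excess M g k' w) (u k' w)
    + \sum_(j < d) dot (volatility M g j k' w) (u k' w) * B k'.+1 w j ord0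
  else wealth0 M.

Definition admissible (dT : measure_display) (T : measurableType dT)
    (R : realType) (P : probability T R) (m d N : nat)
    (B : nat -> T -> 'cV[R]_d) (q : R) (u : nat -> T -> 'cV[R]_m) : Prop :=
  (forall k, (k < N)%N -> mx_measurable_wrt (filtration B k) (u k)) /\
  ('E_P[fun w => (\sum_(k < N) enorm (u k w) `^ q)%R] < +oo)%E.

(* y_gamma(0; u) *)
Definition cost (dT : measure_display) (T : measurableType dT)
    (R : realType) (P : probability T R) (m d N : nat) (M : market T R m d)
    (B : nat -> T -> 'cV[R]_d) (u : nat -> T -> 'cV[R]_m) (g : scenario) :
    \bar R :=
  ('E_P[fun w => (2^-1 * \sum_(k < N) weight M g k w
                           * enorm (u k w - benchmark M k w) ^+ 2
                 - reward M g * wealth M B u g N w)%R])%E.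

(* J(u) *)
Definition robust_cost (dT : measure_display) (T : measurableType dT)
    (R : realType) (P : probability T R) (m d N : nat) (M : market T R m d)
    (B : nat -> T -> 'cV[R]_d) (u : nat -> T -> 'cV[R]_m) : \bar R :=
  ereal_sup [set (\int[l]_g cost P N M B u g)%E | l in @priors R].

Definition excess_mx (dT : measure_display) (T : measurableType dT)
    (R : realType) (m d : nat) (M : market T R m d) (k : nat) (w : T) :
    'M[R]_(m, 2) :=
  \matrix_(i < m, g < 2) excess M g k w i ord0.

Definition volatility_mx (dT : measure_display) (T : measurableType dT)
    (R : realType) (m d : nat) (M : market T R m d) (j : 'I_d) (k : nat)
    (w : T) : 'M[R]_(m, 2) :=
  \matrix_(i < m, g < 2) volatility M g j k w i ord0.

Definition reward_vec (dT : measure_display) (T : measurableType dT)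
    (R : realType) (m d : nat) (M : market T R m d) : 'cV[R]_2 :=
  \col_(g < 2) reward M g.

Definition theta_mx (R : realType) (theta : R) : 'M[R]_2 :=
  diag_mx (\row_(g < 2) (if g == ord0 then theta else 1 - theta)).

Definition weight_mix (dT : measure_display) (T : measurableType dT)
    (R : realType) (m d : nat) (M : market T R m d) (theta : R) (k : nat)
    (w : T) : R :=
  theta * weight M gamma1 k w + (1 - theta) * weight M gamma2 k w.

(* The conditional expectations determine [Pa] and [Qa] up to null sets. *)
Definition adjoint_processes (dT : measure_display) (T : measurableType dT)
    (R : realType) (P : probability T R) (m d N : nat) (M : market T R m d)
    (B : nat -> T -> 'cV[R]_d) (Pa : nat -> T -> 'cV[R]_2)
    (Qa : nat -> T -> 'M[R]_(2, d)) : Prop :=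
  [/\ mx_cond_exp P (filtration B N.-1)
        (fun _ => - reward_vec M) (Pa N.-1),
      mx_cond_exp P (filtration B N.-1)
        (fun w => - reward_vec M *m (B N w)^T) (Qa N.-1),
      forall k, (k.+1 < N)%N -> mx_cond_exp P (filtration B k)
        (fun w => (1 + rate M k.+1) *: Pa k.+1 w) (Pa k) &
      forall k, (k.+1 < N)%N -> mx_cond_exp P (filtration B k)
        (fun w => (1 + rate M k.+1) *: (Pa k.+1 w *m (B k.+1 w)^T)) (Qa k)].

(* Main.v *)
Require Import Defs.
From HB Require Import structures.
From mathcomp Require Import all_boot all_order all_algebra.
From mathcomp Require Import all_classical all_reals all_analysis.
From mathcomp Require Import measurable_realfun ring lra.
Set Implicit Arguments.
Unset Strict Implicit.
Unset Printing Implicit Defensive.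
Import Order.TTheory GRing.Theory Num.Theory.
Import numFieldNormedType.Exports.
Local Open Scope classical_set_scope.
Local Open Scope ring_scope.

(** Since the noise has conditional mean zero, the mean terminal wealth under
    scenario [g] is an affine function of the portfolio, and up to an additive
    constant the cost [y_g(0; v)] is the expectation of a sum over time of
    strictly convex quadratic functions of [v k] ([costE], which rests on
    [integral_mul_eq0] and [wealth_mean]).

    For a fixed [theta] the mixed cost [theta * y_1 + (1 - theta) * y_2] has
    the same form, with weight [weight_mix] bounded below by a positive
    constant.  Completing the square at each time and outcome shows that it is
    minimized by the explicit portfolio [candidate theta]
    ([candidate_minimizes]).

    It remains to choose [theta].  As everything in sight is bounded, the two
    costs of [candidate theta] are Lipschitz functions of [theta]
    ([mean_cost_lip01]), so the intermediate value theorem gives a [theta] for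
    which the larger of the two costs of [u = candidate theta] equals their
    mixture of weight [theta] ([saddle_parameter]).  The pair [(theta, u)] is
    then a saddle point: for every admissible [v],
    [J(u) = max (y_1(u), y_2(u)) = theta * y_1(u) + (1 - theta) * y_2(u)
     <= theta * y_1(v) + (1 - theta) * y_2(v) <= J(v)].

    The interest rate being deterministic, the adjoint equations have the
    deterministic solution [Pa k = - H * prod_(k < i < N) (1 + e i)] and
    [Qa = 0] ([adjoint_solution], by almost sure uniqueness of conditional
    expectations), so that the first-order condition of the theorem is the
    formula defining the candidate. *)

(** * Conditional expectation *)

Section conditional_expectation.
Context (dT : measure_display) (T : measurableType dT) (R : realType).
Context (P : probability T R).
Implicit Types (G : set (set T)) (X Y Z : T -> R).

Lemma sigma_sub_measurable G : G `<=` measurable -> <<s G>> `<=` measurable.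
Proof.
by move=> GT; apply: smallest_sub => //; exact: sigma_algebra_measurable.
Qed.

Lemma measurable_wrt_measurable G Z :
  G `<=` measurable -> measurable_wrt G Z -> measurable_fun setT Z.
Proof.
move=> GT mZ _ U mU; apply: (sigma_sub_measurable GT).
by have := mZ measurableT U mU.
Qed.

Lemma measurable_wrt_preimage G Z (U : set R) :
  measurable U -> measurable_wrt G Z -> <<s G>> (Z @^-1` U).
Proof.
by move=> mU /(_ measurableT U mU); rewrite setTI.
Qed.

(** The sets where [Z] is nonnegative and where it is negative both belong to
    the sigma-algebra, so the integral of [|Z|] is a difference of two
    vanishing integrals. *)
Lemma ae_eq0_of_integrals G Z : G `<=` measurable -> measurable_wrt G Z ->
  P.-integrable setT (EFin \o Z) ->
  (forall A, <<s G>> A -> \int[P]_(w in A) (Z w)%:E = 0)%E ->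
  {ae P, forall w, Z w = 0}.
Proof.
move=> GT mZ iZ Z0.
pose A := Z @^-1` `[0, +oo[; pose A' := Z @^-1` `]-oo, 0[.
have sA : <<s G>> A by exact: measurable_wrt_preimage.
have sA' : <<s G>> A' by exact: measurable_wrt_preimage.
have mA := sigma_sub_measurable GT sA.
have mA' := sigma_sub_measurable GT sA'.
have mZT := measurable_wrt_measurable GT mZ.
have AA' : A `|` A' = setT.
  apply/seteqP; split => // w _; rewrite /A /A' /= !in_itv/= andbT.
  by case: (leP 0 (Z w)); [left|right].
have eZ : measurable_fun setT (EFin \o Z) by exact/measurable_EFinP.
have intA : (\int[P]_(w in A) `|(Z w)%:E| = 0)%E.
  rewrite -[RHS](Z0 _ sA); apply: eq_integral => w /[!inE].
  by rewrite /A /= in_itv/= andbT => w0; rewrite ger0_norm.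
have intA' : (\int[P]_(w in A') `|(Z w)%:E| = 0)%E.
  transitivity (- \int[P]_(w in A') (Z w)%:E)%E; last by rewrite Z0 ?oppe0.
  rewrite -integralN; last first.
    apply: fin_num_adde_defl; rewrite fin_numN.
    by apply: integrable_neg_fin_num => //; exact: integrableS iZ.
  apply: eq_integral => w /[!inE].
  by rewrite /A' /= in_itv/= => w0; rewrite ltr0_norm// EFinN.
have int0 : (\int[P]_(w in setT) `|(Z w)%:E| = 0)%E.
  rewrite -AA' ge0_integral_setU //; [|rewrite AA'; exact: measurableT_comp|].
    by rewrite [X in (X + _)%E]intA [X in (_ + X)%E]intA' adde0.
  rewrite disj_set2E; apply/eqP/seteqP; split => // w [].
  by rewrite /A /A' /= !in_itv/= andbT => /le_lt_trans h /h; rewrite ltxx.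
have [+ _] := @ae_eq_integral_abs _ _ _ P setT measurableT (EFin \o Z) eZ.
by move=> /(_ int0); apply: filterS => w /(_ Logic.I) [].
Qed.

Lemma cond_exp_ae_unique G X Y Y' : G `<=` measurable ->
  cond_exp P G X Y -> cond_exp P G X Y' -> {ae P, forall w, Y w = Y' w}.
Proof.
move=> GT [iX mY iY YX] [_ mY' iY' YX'].
have : {ae P, forall w, (Y \- Y') w = 0}.
  apply: (@ae_eq0_of_integrals G) => //.
  - exact: measurable_funB.
  - exact: (integrableB measurableT iY iY').
  - move=> A sA; have mA := sigma_sub_measurable GT sA.
    have iA := integrableS measurableT mA (@subsetT _ A).
    rewrite integralB_EFin//=; [|exact: iA..].
    by rewrite YX// YX'// subee// integrable_fin_num//; apply: iA.
by apply: filterS => w /= /eqP; rewrite subr_eq0 => /eqP.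
Qed.
End conditional_expectation.

Section conditional_expectation_rules.
Context (dT : measure_display) (T : measurableType dT) (R : realType).
Context (P : probability T R) (G : set (set T)).
Hypothesis GT : G `<=` measurable.
Implicit Types (X Y : T -> R) (c : R).

Lemma cond_exp_cst c : cond_exp P G (fun=> c) (fun=> c).
Proof.
split=> //; [exact: finite_measure_integrable_cst| |
  exact: finite_measure_integrable_cst].
exact: measurable_cst.
Qed.

(** Conditional expectations are classes modulo null sets; this is what lets
    an adjoint process be replaced by the constant it equals almost surely. *)
Lemma cond_exp_ae_congr X X' Y : {ae P, forall w, X w = X' w} ->
  P.-integrable setT (EFin \o X) -> cond_exp P G X' Y -> cond_exp P G X Y.
Proof.
move=> XX' iX [iX' mY iY YX']; split=> // A sA; rewrite YX'//.
have mA := sigma_sub_measurable GT sA.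
apply: ae_eq_integral => //.
- by apply: measurable_funS (measurable_int P iX').
- by apply: measurable_funS (measurable_int P iX).
- by apply: filterS XX' => w -> _.
Qed.

Lemma cond_expZ c X Y : cond_exp P G X Y ->
  cond_exp P G (fun w => c * X w) (fun w => c * Y w).
Proof.
move=> [iX mY iY YX]; split.
- exact: (integrableZl measurableT c iX).
- exact: measurable_funM.
- exact: (integrableZl measurableT c iY).
- move=> A sA; have mA := sigma_sub_measurable GT sA.
  have iA Z (iZ : P.-integrable setT (EFin \o Z)) : P.-integrable A (EFin \o Z).
    exact: integrableS iZ.
  under eq_integral do rewrite EFinM; under [RHS]eq_integral do rewrite EFinM.
  by rewrite !integralZl// ?YX//; exact: iA.
Qed.

End conditional_expectation_rules.

(** If [X] has conditional expectation zero given [<<s G>>], it is orthogonal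
    to every [<<s G>>]-measurable [Z] for which [Z * X] is integrable: this
    holds for simple [Z] by linearity, for nonnegative [Z] by dominated
    convergence with dominating function [|Z * X|], and in general by
    splitting [Z] into positive and negative parts. *)
Section orthogonality.
Import HBNNSimple.
Context (dT : measure_display) (T : measurableType dT) (R : realType).
Context (P : probability T R) (G : set (set T)) (X : T -> R).
Hypothesis GT : G `<=` measurable.
Hypothesis iX : P.-integrable setT (EFin \o X).
Hypothesis X0 : forall A, <<s G>> A -> (\int[P]_(w in A) (X w)%:E = 0)%E.

Let integral_simple_mul_eq0 (h : {nnsfun (g_sigma_algebraType G) >-> R}) :
  (\int[P]_w ((h : T -> R) w * X w)%:E = 0)%E.
Proof.
pose A y : set T := h @^-1` [set y].
have sA y : <<s G>> (A y).
  have := @measurable_funPT _ _ _ _ h measurableT [set y] (measurable_set1 _).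
  by rewrite setTI.
have mA y : measurable (A y) by exact: sigma_sub_measurable (sA y).
(* Multiplying [X] by the indicator of a level set restricts it to that set. *)
have E y (w : T) : ((\1_(A y) w * X w)%:E = ((EFin \o X) \_ (A y)) w)%E.
  by rewrite patchE indicE; case: ifP => _; rewrite ?mul1r ?mul0r.
have iXA y : P.-integrable setT ((EFin \o X) \_ (A y)).
  apply: (integrable_mkcond (EFin \o X) (mA y)).1.
  exact: (integrableS measurableT (mA y) (@subsetT _ _) iX).
have iA y : P.-integrable setT (fun w => (y * (\1_(A y) w * X w))%:E).
  under eq_fun do rewrite EFinM E.
  exact: integrableZl.
under eq_integral do rewrite fimfunE fsbig_finite//= mulr_suml -sumEFin.
under eq_integral do under eq_bigr do rewrite -mulrA.
rewrite (integral_sum measurableT iA) big1// => y _.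
under eq_integral do rewrite EFinM E.
by rewrite integralZl// -integral_mkcond X0// mule0.
Qed.

Let integral_ge0_mul_eq0 (Z : T -> R) : measurable_wrt G Z ->
  (forall w, 0 <= Z w) -> P.-integrable setT (fun w => (Z w * X w)%:E) ->
  (\int[P]_w (Z w * X w)%:E = 0)%E.
Proof.
move=> mZ Z0 iZX.
have mZG : measurable_fun [set: g_sigma_algebraType G]
    (EFin \o (Z : g_sigma_algebraType G -> R)) by exact/measurable_EFinP.
have Z0' (w : g_sigma_algebraType G) :
  setT w -> (0 <= (EFin \o (Z : g_sigma_algebraType G -> R)) w)%E.
  by move=> _; rewrite lee_fin.
pose h n : T -> R := nnsfun_approx measurableT mZG n.
have mh n : measurable_fun setT (h n).
  apply: (measurable_wrt_measurable GT).
  exact: (@measurable_funPT _ _ _ _ (nnsfun_approx measurableT mZG n)).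
have mX : measurable_fun setT X.
  by apply/measurable_EFinP; apply: measurable_int iX.
have hZ w : (h n w @[n --> \oo] --> Z w)%classic.
  have := cvg_nnsfun_approx measurableT mZG Z0' (Logic.I : setT w).
  exact: fine_cvg.
have hle n w : 0 <= h n w <= Z w.
  rewrite fun_ge0/= -lee_fin /h nnsfun_approxE.
  have := @le_approx _ _ _ setT
    (EFin \o (Z : g_sigma_algebraType G -> R)) n w Z0'.
  by apply.
have := @dominated_convergence _ _ _ P setT measurableT
  (fun n w => (h n w * X w)%:E) (fun w => (Z w * X w)%:E)
  (fun w => `|(Z w * X w)%:E|%E).
case.
- by move=> n; apply/measurable_EFinP; exact: measurable_funM.
- exact: measurable_int iZX.
- apply: aeW => w _; apply: cvg_EFin; first exact: nearW.
  by apply: cvgMl; exact: hZ.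
- exact: integrable_abse.
- apply: aeW => w n _; rewrite lee_fin !normrM ler_wpM2r//.
  by have /andP[h0 h1] := hle n w; rewrite !ger0_norm.
move=> _ _ /cvg_lim <-//.
rewrite (_ : (fun _ => _) = cst 0%E) ?lim_cst//.
by apply/funext => n /=; exact: integral_simple_mul_eq0.
Qed.

Lemma integral_mul_eq0 (Z : T -> R) : measurable_wrt G Z ->
  P.-integrable setT (fun w => (Z w * X w)%:E) ->
  (\int[P]_w (Z w * X w)%:E = 0)%E.
Proof.
move=> mZ iZX.
have mX : measurable_fun setT X.
  by apply/measurable_EFinP; apply: measurable_int iX.
have part (Y : T -> R) : measurable_wrt G Y -> (forall w, 0 <= Y w) ->
    (forall w, Y w <= `|Z w|) ->
    P.-integrable setT (fun w => (Y w * X w)%:E) /\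
    (\int[P]_w (Y w * X w)%:E = 0)%E.
  move=> mY Y0 YZ.
  have iYX : P.-integrable setT (fun w => (Y w * X w)%:E).
    apply: le_integrable iZX => //.
      apply/measurable_EFinP; apply: measurable_funM => //.
      exact: measurable_wrt_measurable mY.
    by move=> w _; rewrite lee_fin !normrM ler_wpM2r// ger0_norm.
  by split => //; exact: integral_ge0_mul_eq0.
have [] := part (fun w => Num.max (Z w) 0).
- exact: (@measurable_funrpos _ _ _ _ (Z : g_sigma_algebraType G -> R)).
- by move=> w; rewrite le_max lexx orbT.
- by move=> w; rewrite ge_max ler_norm normr_ge0.
move=> ip p0; have [] := part (fun w => Num.max (- Z w) 0).
- exact: (@measurable_funrneg _ _ _ _ (Z : g_sigma_algebraType G -> R)).
- by move=> w; rewrite le_max lexx orbT.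
- by move=> w; rewrite ge_max normr_ge0 -normrN ler_norm.
move=> im m0; transitivity (\int[P]_w ((Num.max (Z w) 0 * X w)%:E -
                                      (Num.max (- Z w) 0 * X w)%:E))%E.
  apply: eq_integral => w _; rewrite -EFinB -mulrBl; congr (_ * _)%:E.
  by case: (leP (Z w) 0); case: (leP (- Z w) 0); lra.
by rewrite integralB//= p0 m0 sube0.
Qed.

End orthogonality.

(** * Bounded and square-integrable random variables *)

Section square_integrability.
Context (dT : measure_display) (T : measurableType dT) (R : realType).
Context (P : probability T R).
Implicit Types X Y : T -> R.

Lemma ae_le_integrable X Y : measurable_fun setT X ->
  P.-integrable setT (EFin \o Y) -> {ae P, forall w, `|X w| <= `|Y w|} ->
  P.-integrable setT (EFin \o X).
Proof.
move=> mX /integrableP[mY iY] XY.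
have eX : measurable_fun setT (EFin \o X) by exact/measurable_EFinP.
apply/integrableP; split=> //; apply: le_lt_trans iY.
apply: ae_ge0_le_integral => //; [exact: measurableT_comp..|].
by apply: filterS XY => w XYw _; rewrite lee_fin.
Qed.

Lemma integrable_bounded_mul X Y : measurable_fun setT X -> bounded_rv P X ->
  P.-integrable setT (EFin \o Y) ->
  P.-integrable setT (fun w => (X w * Y w)%:E).
Proof.
move=> mX [K XK] iY.
have mY : measurable_fun setT Y.
  by apply/measurable_EFinP; exact: measurable_int iY.
apply: (@ae_le_integrable _ (fun w => K * Y w)).
- exact: measurable_funM.
- exact: (integrableZl measurableT K iY).
- apply: filterS XK => w XK; rewrite !normrM ler_wpM2r//.
  by rewrite (le_trans XK)// ler_norm.
Qed.

Lemma integrable_cst (c : R) : P.-integrable setT (EFin \o cst c).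
Proof. exact: finite_measure_integrable_cst. Qed.

Lemma integrable_bounded X : measurable_fun setT X -> bounded_rv P X ->
  P.-integrable setT (EFin \o X).
Proof.
move=> mX bX; have := integrable_bounded_mul mX bX (integrable_cst 1).
by apply: eq_integrable => // w _ /=; rewrite mulr1.
Qed.

Definition square_integrable X : Prop :=
  measurable_fun setT X /\ P.-integrable setT (fun w => (X w ^+ 2)%:E).

(** From [2 |x y| <= x ^ 2 + y ^ 2]. *)
Lemma square_integrable_mul X Y : square_integrable X -> square_integrable Y ->
  P.-integrable setT (fun w => (X w * Y w)%:E).
Proof.
move=> [mX iX] [mY iY].
apply: le_integrable (integrableD measurableT iX iY) => //.
  by apply/measurable_EFinP; exact: measurable_funM.
move=> w _ /=; rewrite lee_fin [leRHS]ger0_norm ?addr_ge0 ?sqr_ge0//.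
by rewrite ler_norml; apply/andP; split; nra.
Qed.

Lemma square_integrable_cst (c : R) : square_integrable (cst c).
Proof. by split => //=; exact: (integrable_cst (c ^+ 2)). Qed.

Lemma square_integrable_integrable X :
  square_integrable X -> P.-integrable setT (EFin \o X).
Proof.
move=> sX; have := square_integrable_mul sX (square_integrable_cst 1).
by apply: eq_integrable => // w _ /=; rewrite mulr1.
Qed.

Lemma square_integrable_bounded_mul X Y :
  measurable_fun setT X -> bounded_rv P X -> square_integrable Y ->
  square_integrable (fun w => X w * Y w).
Proof.
move=> mX [K XK] [mY iY]; split; first exact: measurable_funM.
under eq_fun do rewrite exprMn.
apply: integrable_bounded_mul => //; first exact: measurable_funX.
exists (K ^+ 2); apply: filterS XK => w XK.
by rewrite normrX lerXn2r// nnegrE (le_trans _ XK).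
Qed.

Lemma square_integrable_bounded X : measurable_fun setT X ->
  bounded_rv P X -> square_integrable X.
Proof.
move=> mX bX.
have := square_integrable_bounded_mul mX bX (square_integrable_cst 1).
by under eq_fun do rewrite mulr1.
Qed.

Lemma square_integrable_add X Y : square_integrable X -> square_integrable Y ->
  square_integrable (fun w => X w + Y w).
Proof.
move=> [mX iX] [mY iY]; split; first exact: measurable_funD.
have iXY : P.-integrable setT (fun w => (2 * (X w ^+ 2 + Y w ^+ 2))%:E).
  exact: (integrableZl measurableT 2 (integrableD measurableT iX iY)).
apply: le_integrable iXY => //.
  by apply/measurable_EFinP/measurable_funX; exact: measurable_funD.
move=> w _ /=; rewrite lee_fin.
rewrite !ger0_norm ?sqr_ge0 ?mulr_ge0 ?addr_ge0 ?sqr_ge0//.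
by have := sqr_ge0 (X w - Y w); nra.
Qed.

Lemma square_integrable_sum (I : Type) (s : seq I) (X : I -> T -> R) :
  (forall i, square_integrable (X i)) ->
  square_integrable (fun w => \sum_(i <- s) X i w).
Proof.
move=> sX; elim: s => [|i s ih].
  by under eq_fun do rewrite big_nil; exact: square_integrable_cst.
by under eq_fun do rewrite big_cons; exact: square_integrable_add.
Qed.

Lemma integrable_sumR (I : Type) (s : seq I) (p : pred I) (X : I -> T -> R) :
  (forall i, p i -> P.-integrable setT (EFin \o X i)) ->
  P.-integrable setT (EFin \o (fun w => \sum_(i <- s | p i) X i w)).
Proof.
move=> iX; have := integrable_sum measurableT s iX.
by apply: eq_integrable => // w _ /=; rewrite sumEFin.
Qed.

Lemma Rintegral_sum (I : Type) (s : seq I) (p : pred I) (X : I -> T -> R) :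
  (forall i, p i -> P.-integrable setT (EFin \o X i)) ->
  \int[P]_w (\sum_(i <- s | p i) X i w) =
  \sum_(i <- s | p i) \int[P]_w (X i w).
Proof.
move=> iX; elim: s => [|i s ih].
  rewrite big_nil; under eq_Rintegral do rewrite big_nil.
  by rewrite Rintegral_cst// mul0r.
under eq_Rintegral do rewrite big_cons; rewrite big_cons.
case: ifPn => // pi; rewrite RintegralD ?ih//; first exact: iX.
exact: integrable_sumR.
Qed.

(** Replacing [Y] by [max X Y], to which it is almost surely equal, reduces
    the claim to monotonicity of the integral for everywhere ordered
    functions. *)
Lemma le_Rintegral_ae X Y : P.-integrable setT (EFin \o X) ->
  P.-integrable setT (EFin \o Y) -> {ae P, forall w, X w <= Y w} ->
  \int[P]_w X w <= \int[P]_w Y w.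
Proof.
move=> iX iY XY.
have mX := measurable_int P iX; have mY := measurable_int P iY.
have iM : P.-integrable setT (EFin \o (fun w => Num.max (X w) (Y w))).
  apply: ae_le_integrable iY _.
    by apply: measurable_maxr; exact/measurable_EFinP.
  by apply: filterS XY => w XY; rewrite max_r.
rewrite [leRHS](_ : _ = \int[P]_w Num.max (X w) (Y w)).
  by apply: le_Rintegral => // w _; rewrite le_max lexx.
congr fine; apply: ae_eq_integral => //; first exact: measurable_int iM.
by apply: filterS XY => w XY _ /=; rewrite max_r.
Qed.

End square_integrability.

Section bounded_random_variables.
Context (dT : measure_display) (T : measurableType dT) (R : realType).
Context (P : probability T R).
Implicit Types (X : T -> R) (c : R).

Lemma bounded_rvB X c : bounded_rv P X -> bounded_rv P (fun w => X w - c).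
Proof.
move=> [K XK]; exists (K + `|c|); apply: filterS XK => w XK.
by rewrite (le_trans (ler_normB _ _))// lerD2r.
Qed.

Lemma bounded_rvZ c X :
  bounded_rv P X -> bounded_rv P (fun w => c * X w).
Proof.
move=> [K XK]; exists (`|c| * K); apply: filterS XK => w XK.
by rewrite normrM ler_wpM2l.
Qed.

End bounded_random_variables.

(** * Lipschitz dependence on a parameter *)

Section lipschitz_in_parameter.
Context (R : realType).
Implicit Types (f g : R -> R) (K L c : R).

(** Boundedness and Lipschitz continuity are carried by one constant, because
    the Lipschitz bound of a product needs the bounds of its factors. *)
Definition lip01 f K : Prop := forall s t, 0 <= s <= 1 -> 0 <= t <= 1 ->
  `|f s| <= K /\ `|f s - f t| <= K * `|s - t|.

Lemma lip01_ge0 f K : lip01 f K -> 0 <= K.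
Proof.
by move=> fK; have [||+ _] := fK 0 0; rewrite ?lexx ?ler01//; exact: le_trans.
Qed.

Lemma lip01_cst c K : `|c| <= K -> lip01 (fun=> c) K.
Proof.
move=> cK s t _ _; split=> //; rewrite subrr normr0 mulr_ge0//.
exact: le_trans cK.
Qed.

Lemma lip01_id : lip01 id 1.
Proof. by move=> s t /andP[s0 s1] _; rewrite ger0_norm// mul1r. Qed.

Lemma lip01_add f g K L : lip01 f K -> lip01 g L ->
  lip01 (fun s => f s + g s) (K + L).
Proof.
move=> fK gL s t s01 t01; have [f1 f2] := fK s t s01 t01.
have [g1 g2] := gL s t s01 t01; split.
  by rewrite (le_trans (ler_normD _ _))// lerD.
rewrite opprD addrACA (le_trans (ler_normD _ _))// mulrDl; exact: lerD.
Qed.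

Lemma lip01_mul f g K L : lip01 f K -> lip01 g L ->
  lip01 (fun s => f s * g s) (2 * K * L).
Proof.
move=> fK gL s t s01 t01; have K0 := lip01_ge0 fK; have L0 := lip01_ge0 gL.
have [f1 f2] := fK s t s01 t01; have [g1 g2] := gL s t s01 t01.
have [f3 _] := fK t s t01 s01; split.
  have fg : `|f s * g s| <= K * L by rewrite normrM ler_pM.
  by rewrite (le_trans fg)// -mulrA ler_peMl ?mulr_ge0// ler1n.
rewrite (_ : _ - _ = (f s - f t) * g s + f t * (g s - g t)); last by ring.
rewrite (le_trans (ler_normD _ _))// !normrM.
rewrite (_ : 2 * _ * _ * _ = K * `|s - t| * L + K * (L * `|s - t|));
  last by ring.
by rewrite lerD ?ler_pM.
Qed.

Lemma lip01_inv f K c : 0 < c -> lip01 f K ->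
  (forall s, 0 <= s <= 1 -> c <= f s) ->
  lip01 (fun s => (f s)^-1) (c^-1 + K * c^-1 ^+ 2).
Proof.
move=> c0 fK fc s t s01 t01; have K0 := lip01_ge0 fK.
have ci0 : 0 < c^-1 by rewrite invr_gt0.
have inv_le r : 0 <= r <= 1 -> 0 <= (f r)^-1 <= c^-1.
  move=> r01; have cf := fc r r01; have f0 := lt_le_trans c0 cf.
  by rewrite invr_ge0 ltW//= lef_pV2.
have /andP[s0 sc] := inv_le s s01; have /andP[t0 tc] := inv_le t t01.
have [_ f2] := fK s t s01 t01; split.
  by rewrite ger0_norm// (le_trans sc)// lerDl mulr_ge0// sqr_ge0.
have fs0 : f s != 0 by rewrite gt_eqF// (lt_le_trans c0)// fc.
have ft0 : f t != 0 by rewrite gt_eqF// (lt_le_trans c0)// fc.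
have -> : (f s)^-1 - (f t)^-1 = (f s)^-1 * (f t)^-1 * - (f s - f t).
  by field; rewrite fs0 ft0.
rewrite !normrM normrN (ger0_norm s0) (ger0_norm t0).
apply: (@le_trans _ _ (c^-1 * c^-1 * (K * `|s - t|))).
  by apply: ler_pM; rewrite ?mulr_ge0 ?ler_pM.
rewrite mulrDl (_ : c^-1 * c^-1 * _ = K * c^-1 ^+ 2 * `|s - t|); last by ring.
by rewrite lerDr mulr_ge0// ltW.
Qed.

Context (dT : measure_display) (T : measurableType dT) (P : probability T R).
Implicit Types F G : R -> T -> R.

(** The constant does not depend on the outcome; this is what survives
    integration. *)
Definition ae_lip01 F : Prop :=
  exists K, {ae P, forall w, lip01 (fun s => F s w) K}.

Lemma ae_lip01_cst (X : T -> R) : bounded_rv P X -> ae_lip01 (fun=> X).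
Proof.
by move=> [K XK]; exists K; apply: filterS XK => w; exact: lip01_cst.
Qed.

Lemma ae_lip01_det f K : lip01 f K -> ae_lip01 (fun s _ => f s).
Proof. by move=> fK; exists K; exact: aeW. Qed.

Lemma ae_lip01_add F G : ae_lip01 F -> ae_lip01 G ->
  ae_lip01 (fun s w => F s w + G s w).
Proof.
move=> [K FK] [L GL]; exists (K + L).
by apply: filterS2 FK GL => w; exact: lip01_add.
Qed.

Lemma ae_lip01_mul F G : ae_lip01 F -> ae_lip01 G ->
  ae_lip01 (fun s w => F s w * G s w).
Proof.
move=> [K FK] [L GL]; exists (2 * K * L).
by apply: filterS2 FK GL => w; exact: lip01_mul.
Qed.

Lemma ae_lip01_convex (X Y : T -> R) : bounded_rv P X -> bounded_rv P Y ->
  ae_lip01 (fun theta w => theta * X w + (1 - theta) * Y w).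
Proof.
move=> bX bY; have lid := ae_lip01_det lip01_id.
have lmid : lip01 (fun theta : R => 1 - theta) 1.
  move=> s t /andP[s0 s1] _; rewrite ger0_norm ?subr_ge0// gerBl s0.
  split=> //; rewrite mul1r distrC.
  by rewrite (_ : _ - _ = s - t) ?lexx//; ring.
apply: ae_lip01_add; apply: ae_lip01_mul => //; last 1 first.
- exact: ae_lip01_cst.
- exact: ae_lip01_cst.
- exact: ae_lip01_det lmid.
Qed.

Lemma ae_lip01_sum (I : Type) (r : seq I) (F : I -> R -> T -> R) :
  (forall i, ae_lip01 (F i)) -> ae_lip01 (fun s w => \sum_(i <- r) F i s w).
Proof.
move=> FK; elim: r => [|i r ih].
  exists 0; apply: aeW => w s t _ _.
  by rewrite !big_nil subrr normr0 mul0r.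
have [K] := ae_lip01_add (FK i) ih; exists K.
by apply: filterS p => w wK s t; rewrite !big_cons; exact: wK.
Qed.

Lemma ae_lip01_inv F c : 0 < c -> ae_lip01 F ->
  {ae P, forall w s, 0 <= s <= 1 -> c <= F s w} ->
  ae_lip01 (fun s w => (F s w)^-1).
Proof.
move=> c0 [K FK] Fc; exists (c^-1 + K * c^-1 ^+ 2).
by apply: filterS2 FK Fc => w; exact: lip01_inv.
Qed.

Lemma ae_lip01_bounded F s : 0 <= s <= 1 -> ae_lip01 F -> bounded_rv P (F s).
Proof.
move=> s01 [K FK]; exists K; apply: filterS FK => w /(_ s s s01 s01).
by case.
Qed.

Lemma lip01_continuous f K : lip01 f K -> {within `[0, 1], continuous f}.
Proof.
move=> fK; have K0 := lip01_ge0 fK; have K1 : 0 < K + 1 by rewrite ltr_wpDl.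
apply/subspace_continuousP => x /=; rewrite in_itv/= => x01.
apply/cvgrPdist_le => /= e e0; rewrite near_withinE; near=> t.
move=> /= t01; rewrite in_itv/= in t01; have [_ fxt] := fK x t x01 t01.
apply: le_trans fxt _.
have xt : `|x - t| <= e / (K + 1).
  by near: t; apply: cvgr_dist_le; [exact: cvg_id | rewrite divr_gt0].
apply: (@le_trans _ _ ((K + 1) * (e / (K + 1)))).
  by rewrite ler_pM// lerDl.
by rewrite mulrC divfK// gt_eqF.
Unshelve. all: by end_near. Qed.

Lemma Rintegral_lip01 F : ae_lip01 F ->
  (forall s, 0 <= s <= 1 -> P.-integrable setT (EFin \o F s)) ->
  exists K, lip01 (fun s => \int[P]_w F s w) K.
Proof.
move=> [K FK] iF; exists K => s t s01 t01.
have le_cst (X : T -> R) (c : R) : P.-integrable setT (EFin \o X) ->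
    {ae P, forall w, `|X w| <= c} -> `|\int[P]_w X w| <= c.
  move=> iX Xc; apply: le_trans (le_normr_Rintegral measurableT iX) _.
  have -> : c = \int[P]_(w in setT) (cst c w).
    rewrite Rintegral_cst//.
    by rewrite [X in fine X]probability_setT mulr1.
  apply: le_Rintegral_ae => //; first exact: (integrable_abse iX).
  exact: integrable_cst.
split.
  apply: le_cst; first exact: iF.
  by apply: filterS FK => w /(_ s t s01 t01) [].
rewrite -RintegralB//; [|exact: iF..].
apply: le_cst; first exact: (integrableB measurableT (iF s s01) (iF t t01)).
by apply: filterS FK => w /(_ s t s01 t01) [].
Qed.

End lipschitz_in_parameter.

(** * Two scenarios and their priors *)

Section scenarios.
Context (R : realType).
Implicit Types (theta : R) (y : scenario -> R).

Lemma scenario_setT : [set: scenario] = [set gamma1] `|` [set gamma2].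
Proof.
apply/seteqP; split=> // g _.
case: (unliftP ord0 g) => [j|] ->; last by left.
by right; rewrite (ord1 j); exact/val_inj.
Qed.

Lemma integral_prior theta (l : probability scenario R) y : is_prior theta l ->
  (\int[l]_g (y g)%:E = (theta * y gamma1 + (1 - theta) * y gamma2)%:E)%E.
Proof.
move=> [l1 l2]; rewrite scenario_setT integral_setU_EFin//; last first.
  by rewrite disj_set2E; apply/eqP/seteqP; split=> // g [/= -> /(congr1 val)].
have int1 g : (\int[l]_(x in [set g]) (y x)%:E = (y g)%:E * l [set g])%E.
  rewrite (eq_integral (cst (y g)%:E)) ?integral_cst// => x.
  by rewrite inE => /= ->.
by rewrite !int1 l1 l2 -!EFinM -EFinD mulrC [X in _ + X]mulrC.
Qed.

(** The prior of weight [theta] is the image of a Bernoulli law under this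
    map. *)
Definition scenario_of_bool (b : bool) : scenario :=
  if b then gamma1 else gamma2.

Lemma prior_exists theta : 0 <= theta <= 1 ->
  exists l : probability scenario R, is_prior theta l.
Proof.
move=> t01.
have mf : measurable_fun [set: bool] scenario_of_bool by [].
pose f := MeasurableFun.Pack (MeasurableFun.Class
  (isMeasurableFun.Build _ _ _ _ _ mf)).
exists (distribution (bernoulli_prob theta) f); split.
  rewrite /distribution/= /pushforward bernoulli_probE// !diracE mem_set//.
  by rewrite memNset ?mule1 ?mule0 ?adde0// => /(congr1 val).
rewrite /distribution/= /pushforward bernoulli_probE// !diracE.
rewrite memNset; last by move=> /(congr1 val).
by rewrite mem_set// mule1 mule0 add0e.
Qed.

Lemma priors_image y :
  [set (\int[l]_g (y g)%:E)%E | l in @priors R] =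
  [set mix t (fun g => (y g)%:E) | t in [set t : R | 0 <= t <= 1]].
Proof.
apply/seteqP; split=> [_ [l [theta [t01 lt] <-]]|_ [theta t01 <-]].
  by exists theta => //; rewrite (integral_prior y lt).
have [l lt] := prior_exists t01; exists l; first by exists theta.
by rewrite (integral_prior y lt).
Qed.

Lemma ereal_sup_mix y :
  ereal_sup [set mix t (fun g => (y g)%:E) | t in [set t : R | 0 <= t <= 1]] =
  maxe (y gamma1)%:E (y gamma2)%:E.
Proof.
have mixE t : mix t (fun g => (y g)%:E) =
    (t * y gamma1 + (1 - t) * y gamma2)%:E by [].
apply/eqP; rewrite eq_le; apply/andP; split.
  apply: ge_ereal_sup => _ [t /= /andP[t0 t1] <-].
  rewrite mixE -EFin_max lee_fin.
  set b := Num.max _ _.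
  have b1 : y gamma1 <= b by rewrite le_max lexx.
  have b2 : y gamma2 <= b by rewrite le_max lexx orbT.
  rewrite (_ : b = t * b + (1 - t) * b); last by ring.
  by rewrite lerD// ler_wpM2l// subr_ge0.
rewrite ge_max; apply/andP; split; apply: ereal_sup_ubound.
  by exists 1; rewrite /= ?ler01 ?lexx// mixE subrr mul1r mul0r addr0.
by exists 0; rewrite /= ?ler01 ?lexx// mixE subr0 mul1r mul0r add0r.
Qed.

(** The maximum of [y1] and [y2] is a mixture of them with weight [theta] on
    [y1] in three cases: [theta = 0] and [y1 <= y2], [theta = 1] and
    [y2 <= y1], or [y1 = y2].  If the first two fail, [y1 - y2] is positive at
    0 and negative at 1, and the third one occurs at one of its zeros. *)
Lemma saddle_parameter (y1 y2 : R -> R) (K1 K2 : R) :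
  lip01 y1 K1 -> lip01 y2 K2 -> exists2 theta, 0 <= theta <= 1 &
    Num.max (y1 theta) (y2 theta) = theta * y1 theta + (1 - theta) * y2 theta.
Proof.
move=> l1 l2.
have [y0|y0] := leP (y1 0) (y2 0).
  by exists 0; rewrite ?lexx ?ler01// mul0r add0r subr0 mul1r max_r.
have [y1'|y1'] := leP (y2 1) (y1 1).
  by exists 1; rewrite ?lexx ?ler01// subrr mul1r mul0r addr0 max_l.
have lN : lip01 (fun=> - 1 : R) 1 by apply: lip01_cst; rewrite normrN normr1.
have lphi := lip01_add l1 (lip01_mul lN l2).
have [] := IVT (v := 0) (@ler01 R) (lip01_continuous lphi).
  rewrite ge_min le_max; apply/andP; split; apply/orP; [right|left]; lra.
move=> t; rewrite in_itv/= => t01 phi0; exists t => //.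
rewrite (_ : y1 t = y2 t); last by lra.
by rewrite maxxx; ring.
Qed.

End scenarios.

(** * The Euclidean norm *)

Section euclidean_norm.
Context (R : realType) (n : nat).
Implicit Types x : 'cV[R]_n.

Lemma enorm_sqr x : enorm x ^+ 2 = \sum_i x i ord0 ^+ 2.
Proof.
rewrite sqr_sqrtr; first by apply: eq_bigr => i _; rewrite expr2.
by apply: sumr_ge0 => i _; rewrite -expr2 sqr_ge0.
Qed.

Lemma enorm_ge0 x : 0 <= enorm x. Proof. exact: sqrtr_ge0. Qed.

Lemma coord_le_enorm x i : `|x i ord0| <= enorm x.
Proof.
rewrite -(@ler_pXn2r _ 2) ?nnegrE ?enorm_ge0// enorm_sqr real_normK ?num_real//.
by rewrite (bigD1 i)//= lerDl; apply: sumr_ge0 => j _; exact: sqr_ge0.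
Qed.

Lemma measurable_enorm (dT : measure_display) (T : measurableType dT)
    (X : T -> 'cV[R]_n) : mx_measurable X ->
  measurable_fun setT (fun w => enorm (X w)).
Proof.
move=> mX; apply: (@measurableT_comp _ _ _ _ _ _ (@Num.sqrt R)).
  by apply: continuous_measurable_fun; exact: sqrt_continuous.
by apply: measurable_sum => i; exact: measurable_funM.
Qed.

Lemma bounded_coord (dT : measure_display) (T : measurableType dT)
    (P : probability T R) (X : T -> 'cV[R]_n) i :
  bounded_rvec P X -> bounded_rv P (fun w => X w i ord0).
Proof.
move=> [K XK]; exists K; apply: filterS XK => w; apply: le_trans.
by rewrite (le_trans (coord_le_enorm _ i))// ler_norm.
Qed.

End euclidean_norm.

(** Inversion is continuous off the origin, which is split off because there
    it is only a convention. *)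
Lemma measurable_inv (R : realType) : measurable_fun setT (@GRing.inv R).
Proof.
rewrite -(setvU [set 0 : R]); apply/measurable_funU => //.
  by apply: measurableC; exact: measurable_set1.
split.
  apply: open_continuous_measurable_fun.
    by apply: closed_openC; exact: closed_eq.
  by move=> x /[!inE] /= /eqP x0; exact: inv_continuous.
move=> _ U mU; have [U0|U0] := pselect (U (0^-1 : R)).
  by rewrite (_ : _ `&` _ = [set 0]); [exact: measurable_set1|
    apply/seteqP; split => [x []//|x /= ->]].
by rewrite (_ : _ `&` _ = set0)//; apply/seteqP; split => [x [/= -> /U0]|].
Qed.

(** * The mean cost of a square-integrable control *)

Section model.
Context (dT : measure_display) (T : measurableType dT) (R : realType).
Context (P : probability T R) (m d N : nat) (B : nat -> T -> 'cV[R]_d).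
Context (M : market T R m d).
Hypothesis B_meas : forall k, (0 < k <= N)%N -> mx_measurable (B k).
Hypothesis B_mean : forall (k : nat) (j : 'I_d), (k < N)%N ->
  cond_exp P (filtration B k) (fun w => B k.+1 w j ord0) (fun _ => 0).
Hypothesis B_var : forall (k : nat) (j : 'I_d), (k < N)%N ->
  cond_exp P (filtration B k) (fun w => B k.+1 w j ord0 ^+ 2) (fun _ => 1).
Hypothesis appreciation_meas : forall g k, (k < N)%N ->
  mx_measurable_wrt (filtration B k) (appreciation M g k).
Hypothesis appreciation_bounded : forall g k, (k < N)%N ->
  bounded_rvec P (appreciation M g k).
Hypothesis volatility_meas : forall g j k, (k < N)%N ->
  mx_measurable_wrt (filtration B k) (volatility M g j k).
Hypothesis volatility_bounded : forall g j k, (k < N)%N ->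
  bounded_rvec P (volatility M g j k).
Hypothesis benchmark_meas : forall k, (k < N)%N ->
  mx_measurable_wrt (filtration B k) (benchmark M k).
Hypothesis benchmark_bounded : forall k, (k < N)%N ->
  bounded_rvec P (benchmark M k).
Hypothesis weight_meas : forall g k, (k < N)%N ->
  measurable_wrt (filtration B k) (weight M g k).
Hypothesis weight_bounded : forall g k, (k < N)%N ->
  bounded_rv P (weight M g k).

Implicit Types (u v : nat -> T -> 'cV[R]_m) (g : scenario).

Lemma filtration_measurable k : (k <= N)%N -> filtration B k `<=` measurable.
Proof.
move=> kN A [l /= /andP[l0 lk]] [[i j] _] [U mU <-].
by apply: B_meas => //; rewrite l0 (leq_trans lk).
Qed.

Lemma noise_square_integrable k j : (k < N)%N ->
  square_integrable P (fun w => B k.+1 w j ord0).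
Proof. by move=> kN; split; [exact: B_meas | have [] := B_var j kN]. Qed.

Lemma excess_measurable g k i : (k < N)%N ->
  measurable_wrt (filtration B k) (fun w => excess M g k w i ord0).
Proof.
move=> kN; rewrite /measurable_wrt/=.
under eq_fun do rewrite !mxE mulr1.
by apply: measurable_funB => //; exact: appreciation_meas.
Qed.

Lemma excess_bounded g k i : (k < N)%N ->
  bounded_rv P (fun w => excess M g k w i ord0).
Proof.
move=> kN; under eq_fun do rewrite !mxE mulr1.
by apply: bounded_rvB; apply: bounded_coord; exact: appreciation_bounded.
Qed.

Lemma measurable_at k (X : T -> R) : (k < N)%N ->
  measurable_wrt (filtration B k) X -> measurable_fun setT X.
Proof.
move=> kN; apply: measurable_wrt_measurable.
by apply: filtration_measurable; exact: ltnW.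
Qed.

(** Square integrability, which admissibility implies because [2 < q], makes
    the tracking error and the product with the square-integrable noise
    integrable. *)
Definition L2_control v : Prop := forall k, (k < N)%N ->
  mx_measurable_wrt (filtration B k) (v k) /\
  forall i, square_integrable P (fun w => v k w i ord0).

Lemma dot_square_integrable (X : T -> 'cV[R]_m) v k : (k < N)%N ->
  (forall i, measurable_fun setT (fun w => X w i ord0)) ->
  (forall i, bounded_rv P (fun w => X w i ord0)) ->
  L2_control v -> square_integrable P (fun w => dot (X w) (v k w)).
Proof.
move=> kN mX bX vL2; apply: square_integrable_sum => i.
by apply: square_integrable_bounded_mul => //; exact: (vL2 k kN).2.
Qed.

Lemma excess_dot_square_integrable v g k : (k < N)%N -> L2_control v ->
  square_integrable P (fun w => dot (excess M g k w) (v k w)).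
Proof.
move=> kN; apply: dot_square_integrable => // i.
  by apply: (measurable_at kN); exact: excess_measurable.
exact: excess_bounded.
Qed.

Lemma volatility_dot_square_integrable v g j k : (k < N)%N -> L2_control v ->
  square_integrable P (fun w => dot (volatility M g j k w) (v k w)).
Proof.
move=> kN; apply: dot_square_integrable => // i.
  by apply: (measurable_at kN); exact: volatility_meas.
by apply: bounded_coord; exact: volatility_bounded.
Qed.

(** The integrand of the noise is known at time [k], when the next noise has
    conditional mean zero. *)
Lemma diffusion_mean0 v g j k : (k < N)%N -> L2_control v ->
  P.-integrable setT (EFin \o (fun w =>
    dot (volatility M g j k w) (v k w) * B k.+1 w j ord0)) /\
  \int[P]_w (dot (volatility M g j k w) (v k w) * B k.+1 w j ord0) = 0.
Proof.
move=> kN vL2.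
have iVB : P.-integrable setT (EFin \o (fun w =>
    dot (volatility M g j k w) (v k w) * B k.+1 w j ord0)).
  apply: square_integrable_mul; last exact: noise_square_integrable.
  exact: volatility_dot_square_integrable.
split=> //; have [iB _ _ B0] := B_mean j kN.
rewrite /Rintegral (integral_mul_eq0 (filtration_measurable (ltnW kN)) iB)//.
- by move=> A sA; rewrite -B0// integral0.
- rewrite /measurable_wrt; apply: measurable_sum => i.
  apply: measurable_funM; first exact: volatility_meas.
  exact: (vL2 k kN).1.
Qed.

(** The value at time [n] of one unit invested in the bond at time [k]. *)
Definition compound k n : R := \prod_(k <= i < n) (1 + rate M i).

Lemma compound_nil k : compound k k = 1.
Proof. by rewrite /compound big_geq. Qed.

Lemma compoundS k n : (k <= n)%N ->
  compound k n.+1 = (1 + rate M n) * compound k n.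
Proof. by move=> kn; rewrite /compound big_nat_recr//= mulrC. Qed.

(** The gain earned at time [i] is reinvested at the riskless rate until time
    [k]; the noise contributes nothing to the mean. *)
Lemma wealth_mean v g k : L2_control v -> (k <= N)%N ->
  P.-integrable setT (EFin \o wealth M B v g k) /\
  \int[P]_w wealth M B v g k w = compound 0 k * wealth0 M +
    \sum_(i < k) compound i.+1 k * \int[P]_w dot (excess M g i w) (v i w).
Proof.
move=> vL2; elim: k => [_|k ih kN].
  split; first exact: integrable_cst.
  rewrite [LHS](Rintegral_cst P measurableT (wealth0 M)).
  rewrite [X in fine X]probability_setT mulr1.
  by rewrite compound_nil mul1r big_ord0 addr0.
have [iW W] := ih (ltnW kN).
have iRW : P.-integrable setT
    (EFin \o (fun w => (1 + rate M k) * wealth M B v g k w)).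
  exact: (integrableZl measurableT (1 + rate M k) iW).
have iA := square_integrable_integrable
  (excess_dot_square_integrable g kN vL2).
have iRWA := integrableD measurableT iRW iA.
have iV j := (diffusion_mean0 g j kN vL2).1.
have iS : P.-integrable setT (EFin \o (fun w =>
  \sum_(j < d) dot (volatility M g j k w) (v k w) * B k.+1 w j ord0)).
  exact: integrable_sumR.
split; first exact: (integrableD measurableT iRWA iS).
rewrite RintegralD// RintegralD// RintegralZl//.
rewrite [X in _ + X = _]Rintegral_sum//.
rewrite [X in _ + X = _]big1 => [|j _];
  last exact: (diffusion_mean0 g j kN vL2).2.
rewrite addr0.
rewrite W [in RHS]big_ord_recr/= compound_nil mul1r addrA; congr (_ + _).
rewrite compoundS// mulrDr mulrA; congr (_ + _).
rewrite mulr_sumr; apply: eq_bigr => i _.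
by rewrite compoundS ?ltn_ord// mulrA.
Qed.

(** The part of the cost that the decision [x] taken at time [k] controls:
    the terminal wealth being linear in the decisions, the cost is in mean a
    sum of such terms. *)
Definition stage_cost g k w (x : 'cV[R]_m) : R :=
  2^-1 * weight M g k w * enorm (x - benchmark M k w) ^+ 2
  - reward M g * compound k.+1 N * dot (excess M g k w) x.

Definition total_stage_cost v g (w : T) : R :=
  \sum_(k < N) stage_cost g k w (v k w).

Definition mean_cost v g : R :=
  \int[P]_w total_stage_cost v g w - reward M g * (compound 0 N * wealth0 M).

Lemma tracking_integrable v g k : (k < N)%N -> L2_control v ->
  P.-integrable setT (EFin \o (fun w =>
    2^-1 * weight M g k w * enorm (v k w - benchmark M k w) ^+ 2)).
Proof.
move=> kN vL2; have mw := measurable_at kN (weight_meas g kN).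
apply: (integrable_bounded_mul (X := fun w => 2^-1 * weight M g k w)).
- exact: measurable_funM.
- have [K wK] := weight_bounded g kN; exists (2^-1 * K).
  by apply: filterS wK => w wK; rewrite normrM ger0_norm// ler_wpM2l.
- under [X in EFin \o X]eq_fun do rewrite enorm_sqr.
  apply: integrable_sumR => i _.
  have sb : square_integrable P (fun w => benchmark M k w i ord0).
    apply: square_integrable_bounded.
      by apply: (measurable_at kN); exact: benchmark_meas.
    by apply: bounded_coord; exact: benchmark_bounded.
  have sNb : square_integrable P (fun w => - 1 * benchmark M k w i ord0).
    apply: square_integrable_bounded_mul => //.
    by exists 1; apply: aeW => w; rewrite normrN normr1.
  have [_] := square_integrable_add ((vL2 k kN).2 i) sNb.
  by apply: eq_integrable => // w _ /=; rewrite !mxE mulN1r.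
Qed.

Lemma stage_cost_mean v g k : (k < N)%N -> L2_control v ->
  P.-integrable setT (EFin \o (fun w => stage_cost g k w (v k w))) /\
  \int[P]_w stage_cost g k w (v k w) =
    \int[P]_w (2^-1 * weight M g k w * enorm (v k w - benchmark M k w) ^+ 2)
    - reward M g * compound k.+1 N *
      \int[P]_w dot (excess M g k w) (v k w).
Proof.
move=> kN vL2; have iT := tracking_integrable g kN vL2.
have iA := square_integrable_integrable
  (excess_dot_square_integrable g kN vL2).
have iZA : P.-integrable setT (EFin \o (fun w =>
    reward M g * compound k.+1 N * dot (excess M g k w) (v k w))).
  exact: (integrableZl measurableT (reward M g * compound k.+1 N) iA).
split; first exact: (integrableB measurableT iT iZA).
by rewrite /stage_cost RintegralB// RintegralZl.
Qed.

Lemma total_stage_cost_integrable v g : L2_control v ->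
  P.-integrable setT (EFin \o total_stage_cost v g).
Proof.
move=> vL2; apply: integrable_sumR => k _.
exact: (stage_cost_mean g (ltn_ord k) vL2).1.
Qed.

Lemma costE v g : L2_control v -> cost P N M B v g = (mean_cost v g)%:E.
Proof.
move=> vL2; rewrite /cost unlock.
under eq_integral do rewrite mulr_sumr.
under eq_integral do under eq_bigr do rewrite mulrA.
have [iW W] := wealth_mean g vL2 (leqnn N).
have iT : P.-integrable setT (EFin \o (fun w => \sum_(k < N)
    2^-1 * weight M g k w * enorm (v k w - benchmark M k w) ^+ 2)).
  by apply: integrable_sumR => k _; exact: tracking_integrable.
have iRW : P.-integrable setT
    (EFin \o (fun w => reward M g * wealth M B v g N w)).
  exact: (integrableZl measurableT (reward M g) iW).
rewrite -[LHS]fineK; last first.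
  exact: integrable_fin_num (integrableB measurableT iT iRW).
congr _%:E; rewrite -/(Rintegral _ _ _) RintegralB// RintegralZl// W.
rewrite Rintegral_sum; last by move=> k _; exact: tracking_integrable.
rewrite /mean_cost Rintegral_sum; last first.
  by move=> k _; exact: (stage_cost_mean g (ltn_ord k) vL2).1.
under [in RHS]eq_bigr => k _ do rewrite (stage_cost_mean g (ltn_ord k) vL2).2.
rewrite sumrB mulrDr opprD addrCA addrC mulr_sumr.
congr (_ - _ - _).
by apply: eq_bigr => i _; rewrite mulrA.
Qed.

(** From [x ^ 2 <= 1 + x ^ q]. *)
Lemma admissible_L2 q v : 2 < q -> admissible P N B q v -> L2_control v.
Proof.
move=> q2 [mv vq] k kN; split=> [|i]; first exact: mv.
have mvT l : (l < N)%N -> mx_measurable (v l).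
  by move=> lN i' j'; apply: (measurable_at lN); exact: mv.
split; first exact: mvT.
have q0 (l : 'I_N) w : 0 <= enorm (v l w) `^ q by exact: powR_ge0.
have mS : measurable_fun setT (fun w => \sum_(l < N) enorm (v l w) `^ q).
  apply: measurable_sum => l.
  apply: (@measurableT_comp _ _ _ _ _ _ (@powR R ^~ q)).
    exact: measurable_powR.
  by apply: measurable_enorm; exact: mvT.
have iS : P.-integrable setT
    (EFin \o (fun w => \sum_(l < N) enorm (v l w) `^ q)).
  apply/integrableP; split; first exact/measurable_EFinP.
  move: vq; rewrite unlock; apply: le_lt_trans; rewrite le_eqVlt.
  apply/orP; left; apply/eqP; apply: eq_integral => w _ /=.
  by rewrite ger0_norm// sumr_ge0.
apply: le_integrable (integrableD measurableT (integrable_cst P 1) iS) => //.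
  by apply/measurable_EFinP/measurable_funX; exact: mvT.
move=> w _ /=; rewrite lee_fin !ger0_norm ?sqr_ge0 ?addr_ge0 ?sumr_ge0//.
have e0 := enorm_ge0 (v k w).
apply: (@le_trans _ _ (enorm (v k w) ^+ 2)).
  rewrite -(real_normK (num_real (v k w i ord0))).
  by rewrite lerXn2r ?nnegrE ?coord_le_enorm.
have : enorm (v k w) ^+ 2 <= 1 + enorm (v k w) `^ q.
  case: (leP (enorm (v k w)) 1) => e1.
    by rewrite (@le_trans _ _ 1) ?exprn_ile1// lerDl powR_ge0.
  rewrite -powR_mulrn// (@le_trans _ _ (enorm (v k w) `^ q)) ?lerDr//.
  by rewrite ler_powR// ltW.
move/le_trans; apply; rewrite lerD2l (bigD1 (Ordinal kN))//= lerDl.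
exact: sumr_ge0.
Qed.

(** * The portfolio that is optimal for a fixed prior *)

Hypothesis weight_gg0 : forall g k, (k < N)%N ->
  exists c : R, 0 < c /\ {ae P, forall w, c <= weight M g k w}.

Definition candidate (theta : R) k w : 'cV[R]_m :=
  benchmark M k w + (weight_mix M theta k w)^-1 *:
    (compound k.+1 N *: (excess_mx M k w *m theta_mx theta *m reward_vec M)).

Lemma excess_theta_mulE theta k w i (y : 'cV[R]_2) :
  (excess_mx M k w *m theta_mx theta *m y) i ord0 =
  theta * excess M gamma1 k w i ord0 * y gamma1 ord0 +
  (1 - theta) * excess M gamma2 k w i ord0 * y gamma2 ord0.
Proof.
rewrite /theta_mx mul_mx_diag mxE !big_ord_recl big_ord0 addr0 !mxE/=.
rewrite (_ : lift ord0 ord0 = gamma2); last exact/val_inj.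
by rewrite -/gamma1; congr (_ + _); rewrite [X in X * _]mulrC.
Qed.

(** The entries of [excess_mx *m theta_mx theta *m reward_vec], see
    [excess_theta_mulE]. *)
Definition drift_gain theta k w i : R :=
  theta * reward M gamma1 * excess M gamma1 k w i ord0 +
  (1 - theta) * reward M gamma2 * excess M gamma2 k w i ord0.

Lemma candidateE theta k w i : candidate theta k w i ord0 =
  benchmark M k w i ord0 +
  (weight_mix M theta k w)^-1 * (compound k.+1 N * drift_gain theta k w i).
Proof.
have H g : reward_vec M g ord0 = reward M g by rewrite mxE.
rewrite 3!mxE excess_theta_mulE !H /drift_gain.
by congr (_ + _ * (_ * _)); ring.
Qed.

Lemma stage_costE g k w x : stage_cost g k w x =
  \sum_i (2^-1 * weight M g k w * (x i ord0 - benchmark M k w i ord0) ^+ 2 -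
          reward M g * compound k.+1 N * (excess M g k w i ord0 * x i ord0)).
Proof.
rewrite /stage_cost enorm_sqr sumrB -!mulr_sumr; congr (_ * _ - _).
by apply: eq_bigr => i _; rewrite !mxE.
Qed.

Lemma mixed_stage_costE theta k w x :
  theta * stage_cost gamma1 k w x + (1 - theta) * stage_cost gamma2 k w x =
  \sum_i (2^-1 * weight_mix M theta k w *
            (x i ord0 - benchmark M k w i ord0) ^+ 2 -
          compound k.+1 N * drift_gain theta k w i * x i ord0).
Proof.
rewrite !stage_costE !mulr_sumr -big_split/=; apply: eq_bigr => i _.
by rewrite /weight_mix /drift_gain; ring.
Qed.

(** With [W] the mixed weight and [a] the compounded drift gain, each
    coordinate contributes [W / 2 * (x - psi) ^ 2 - a * x], a parabola with
    vertex at [psi + a / W]. *)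
Lemma candidate_minimizes_stage theta k w x : 0 < weight_mix M theta k w ->
  theta * stage_cost gamma1 k w (candidate theta k w) +
    (1 - theta) * stage_cost gamma2 k w (candidate theta k w) <=
  theta * stage_cost gamma1 k w x + (1 - theta) * stage_cost gamma2 k w x.
Proof.
move=> W0; rewrite !mixed_stage_costE; apply: ler_sum => i _.
rewrite candidateE.
set W := weight_mix _ _ _ _; set a := compound _ _ * _.
set psi := benchmark _ _ _ _ _; set xi := x _ _.
(* Write [a] as [W * b]: the two sides then differ by
   [W / 2 * (xi - psi - b) ^ 2]. *)
have aE : a = W * (W^-1 * a) by rewrite mulrA divff ?mul1r// gt_eqF.
move: (W^-1 * a) aE => b ->; rewrite addrAC subrr add0r -subr_ge0.
rewrite (_ : _ - _ = 2^-1 * W * (xi - psi - b) ^+ 2); last by field.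
by rewrite mulr_ge0 ?sqr_ge0// mulr_ge0// ltW.
Qed.

(** Both weights exceed a positive constant, hence so do all their mixtures;
    the bound holds off a single null set for all [theta] at once. *)
Lemma weight_mix_lower_bound k : (k < N)%N -> exists2 c, 0 < c &
  {ae P, forall w theta, 0 <= theta <= 1 -> c <= weight_mix M theta k w}.
Proof.
move=> kN; have [c1 [c10 w1]] := weight_gg0 gamma1 kN.
have [c2 [c20 w2]] := weight_gg0 gamma2 kN.
exists (Num.min c1 c2); first by rewrite lt_min c10.
apply: filterS2 w1 w2 => w w1 w2 theta /andP[t0 t1].
set c := Num.min _ _.
have cc1 : c <= c1 by rewrite ge_min lexx.
have cc2 : c <= c2 by rewrite ge_min lexx orbT.
rewrite (_ : c = theta * c + (1 - theta) * c); last by ring.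
by rewrite lerD// ler_wpM2l ?subr_ge0//;
  [exact: le_trans w1|exact: le_trans w2].
Qed.

Lemma candidate_excess_lip01 k i : (k < N)%N ->
  ae_lip01 P (fun theta w => (weight_mix M theta k w)^-1 *
    (compound k.+1 N * drift_gain theta k w i)).
Proof.
move=> kN; have [c c0 Wc] := weight_mix_lower_bound kN.
apply: ae_lip01_mul.
  by apply: ae_lip01_inv c0 _ Wc; apply: ae_lip01_convex; exact: weight_bounded.
apply: ae_lip01_mul; first exact: ae_lip01_det (lip01_cst (lexx _)).
rewrite /drift_gain.
have [K dK] := ae_lip01_convex
  (bounded_rvZ (reward M gamma1) (excess_bounded gamma1 i kN))
  (bounded_rvZ (reward M gamma2) (excess_bounded gamma2 i kN)).
by exists K; apply: filterS dK => w wK s t; rewrite -!mulrA; exact: wK.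
Qed.

Lemma candidate_lip01 k i : (k < N)%N ->
  ae_lip01 P (fun theta w => candidate theta k w i ord0).
Proof.
move=> kN; have bP := bounded_coord i (benchmark_bounded kN).
have [K dK] := ae_lip01_add (ae_lip01_cst bP) (candidate_excess_lip01 i kN).
by exists K; apply: filterS dK => w wK s t; rewrite !candidateE; exact: wK.
Qed.

Lemma stage_cost_lip01 g k : (k < N)%N ->
  ae_lip01 P (fun theta w => stage_cost g k w (candidate theta k w)).
Proof.
move=> kN.
have lcst (c : R) : ae_lip01 P (fun _ _ => c).
  by apply: ae_lip01_cst; exists `|c|; exact: aeW.
have lw := ae_lip01_mul (lcst 2^-1) (ae_lip01_cst (weight_bounded g kN)).
have lx i := candidate_excess_lip01 i kN.
have lA i := ae_lip01_mul (lcst (- (reward M g * compound k.+1 N)))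
  (ae_lip01_mul (ae_lip01_cst (excess_bounded g i kN)) (candidate_lip01 i kN)).
have [K sK] := ae_lip01_sum (index_enum 'I_m) (fun i =>
  ae_lip01_add (ae_lip01_mul lw (ae_lip01_mul (lx i) (lx i))) (lA i)).
exists K; apply: filterS sK => w sK s t s01 t01.
have E r : stage_cost g k w (candidate r k w) =
    \sum_i (2^-1 * weight M g k w * ((weight_mix M r k w)^-1 *
         (compound k.+1 N * drift_gain r k w i) * ((weight_mix M r k w)^-1 *
         (compound k.+1 N * drift_gain r k w i))) +
      - (reward M g * compound k.+1 N) *
        (excess M g k w i ord0 * candidate r k w i ord0)).
  rewrite stage_costE; apply: eq_bigr => i _; rewrite mulNr.
  by congr (_ * _ - _); rewrite candidateE addrAC subrr add0r expr2.
by rewrite !E; exact: sK.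
Qed.

Lemma candidate_measurable theta k : (k < N)%N ->
  mx_measurable_wrt (filtration B k) (candidate theta k).
Proof.
move=> kN i j; rewrite (ord1 j) /measurable_wrt.
under eq_fun do rewrite candidateE.
apply: measurable_funD; first exact: benchmark_meas.
apply: measurable_funM.
  apply: (@measurableT_comp _ _ _ _ _ _ (@GRing.inv R)).
    exact: measurable_inv.
  by apply: measurable_funD; apply: measurable_funM => //; exact: weight_meas.
apply: measurable_funM => //.
apply: measurable_funD; apply: measurable_funM => //;
  exact: excess_measurable.
Qed.

Lemma candidate_L2 theta : 0 <= theta <= 1 -> L2_control (candidate theta).
Proof.
move=> t01 k kN; have mC := candidate_measurable theta kN; split=> // i.
apply: square_integrable_bounded; first exact: (measurable_at kN (mC i ord0)).
exact: (ae_lip01_bounded t01 (candidate_lip01 i kN)).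
Qed.

Lemma candidate_admissible theta q : 0 <= theta <= 1 -> 0 <= q ->
  admissible P N B q (candidate theta).
Proof.
move=> t01 q0; split=> [k kN|]; first exact: candidate_measurable.
have iq (k : 'I_N) : P.-integrable setT
    (EFin \o (fun w => enorm (candidate theta k w) `^ q)).
  apply: integrable_bounded.
    apply: (@measurableT_comp _ _ _ _ _ _ (@powR R ^~ q)).
      exact: measurable_powR.
    apply: measurable_enorm => i j; apply: (measurable_at (ltn_ord k)).
    exact: candidate_measurable.
  have [K nK] := ae_lip01_sum (index_enum 'I_m)
    (fun i => ae_lip01_mul (candidate_lip01 i (ltn_ord k))
                           (candidate_lip01 i (ltn_ord k))).
  exists (Num.sqrt K `^ q); apply: filterS nK => w nK.
  have [nK' _] := nK _ _ t01 t01.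
  rewrite ger0_norm ?powR_ge0// ge0_ler_powR// ?nnegrE ?sqrtr_ge0//.
  by rewrite /enorm ler_wsqrtr// (le_trans _ nK')// ler_norm.
rewrite unlock; apply: (integrable_lty measurableT).
exact: (integrable_sumR (index_enum 'I_N) (fun k _ => iq k)).
Qed.

(** The stage cost of the candidate is built from bounded random variables,
    [theta], and the inverse of the mixed weight by sums and products, so it
    is Lipschitz in [theta] uniformly in the outcome. *)
Lemma mean_cost_lip01 g :
  exists K, lip01 (fun theta => mean_cost (candidate theta) g) K.
Proof.
have lS : ae_lip01 P (fun theta => total_stage_cost (candidate theta) g).
  by apply: ae_lip01_sum => k; exact: stage_cost_lip01.
have [K IK] := Rintegral_lip01 lS
  (fun s s01 => total_stage_cost_integrable g (candidate_L2 s01)).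
exists (K + `|- (reward M g * (compound 0 N * wealth0 M))|).
by apply: lip01_add IK _; exact: lip01_cst.
Qed.

Lemma candidate_minimizes theta v : 0 <= theta <= 1 -> L2_control v ->
  theta * mean_cost (candidate theta) gamma1 +
    (1 - theta) * mean_cost (candidate theta) gamma2 <=
  theta * mean_cost v gamma1 + (1 - theta) * mean_cost v gamma2.
Proof.
move=> t01 vL2; have cL2 := candidate_L2 t01.
have iZ u (c : R) g : L2_control u ->
    P.-integrable setT (EFin \o (fun w => c * total_stage_cost u g w)).
  move=> uL2; have iS := total_stage_cost_integrable g uL2.
  exact: (integrableZl measurableT c iS).
have iM u : L2_control u -> P.-integrable setT (EFin \o (fun w =>
    theta * total_stage_cost u gamma1 w +
    (1 - theta) * total_stage_cost u gamma2 w)).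
  by move=> uL2; exact: (integrableD measurableT (iZ _ _ _ uL2) (iZ _ _ _ uL2)).
have E u : L2_control u ->
    theta * mean_cost u gamma1 + (1 - theta) * mean_cost u gamma2 =
    \int[P]_w (theta * total_stage_cost u gamma1 w +
               (1 - theta) * total_stage_cost u gamma2 w) -
    (theta * (reward M gamma1 * (compound 0 N * wealth0 M)) +
     (1 - theta) * (reward M gamma2 * (compound 0 N * wealth0 M))).
  move=> uL2; rewrite RintegralD//; [|exact: iZ..].
  rewrite !RintegralZl//; [|exact: total_stage_cost_integrable..].
  by rewrite /mean_cost; ring.
rewrite !E// lerD2r; apply: le_Rintegral_ae; [exact: iM..|].
have Wpos : {ae P, forall w k, (k < N)%N -> 0 < weight_mix M theta k w}.
  apply/ae_foralln => k; have [kN|] := boolP (k < N)%N; last first.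
    by move=> kN; exact: aeW.
  have [c c0 Wc] := weight_mix_lower_bound kN.
  by apply: filterS Wc => w Wc _; exact: lt_le_trans c0 (Wc _ t01).
apply: filterS Wpos => w Wpos; rewrite /total_stage_cost !mulr_sumr.
rewrite -!big_split/=; apply: ler_sum => k _.
by apply: candidate_minimizes_stage; exact: Wpos.
Qed.

(** * The adjoint processes *)

Context (Pa : nat -> T -> 'cV[R]_2) (Qa : nat -> T -> 'M[R]_(2, d)).
Hypothesis PQ_adjoint : adjoint_processes P N M B Pa Qa.

(** By backward induction: a deterministic [Pa (k.+1)] makes [Pa k]
    deterministic and turns [Qa k] into a multiple of the conditional mean of
    the noise, which is zero. *)
Lemma adjoint_solution k : (k < N)%N ->
  {ae P, forall w, Pa k w = - (compound k.+1 N *: reward_vec M)} /\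
  {ae P, forall w, Qa k w = 0}.
Proof.
have [PN QN Pk Qk] := PQ_adjoint.
have noise0 l (c : R) j : (l < N)%N ->
    cond_exp P (filtration B l) (fun w => c * B l.+1 w j ord0) (fun=> 0).
  move=> lN; have Fl := filtration_measurable (ltnW lN).
  have := cond_expZ Fl c (B_mean j lN).
  by under [X in cond_exp _ _ _ X]eq_fun do rewrite mulr0.
move=> kN; have [l kl] : exists l, (k + l.+1)%N = N.
  by exists (N - k.+1)%N; rewrite addnS -addSn subnKC.
elim: l k kN kl => [|l ih] k kN kl.
  have FN := filtration_measurable (ltnW kN).
  have Nk1 : N = k.+1 by rewrite -kl addn1.
  have Nk : N.-1 = k by rewrite Nk1.
  rewrite Nk in PN QN; split.
    have PNk g : {ae P, forall w, Pa k w g ord0 = - reward M g}.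
      apply: (cond_exp_ae_unique FN (PN g ord0)).
      rewrite (_ : (fun _ => _) = fun=> - reward M g).
        exact: cond_exp_cst.
      by apply/funext => w; rewrite !mxE.
    apply: filterS (filter_forall _ PNk) => w Pw.
    rewrite Nk1 compound_nil scale1r.
    by apply/matrixP => g j; rewrite (ord1 j) Pw !mxE.
  have QNk (gj : 'I_2 * 'I_d) : {ae P, forall w, Qa k w gj.1 gj.2 = 0}.
    apply: (cond_exp_ae_unique FN (QN gj.1 gj.2)).
    rewrite (_ : (fun _ => _) = fun w => - reward M gj.1 * B k.+1 w gj.2 ord0).
      exact: noise0.
    by apply/funext => w; rewrite mxE big_ord1 !mxE Nk1.
  apply: filterS (filter_forall _ QNk) => w Qw; apply/matrixP => g j.
  by rewrite (Qw (g, j)) mxE.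
have k1N : (k.+1 < N)%N by rewrite -kl !addnS !ltnS leq_addr.
have [Pih _] := ih k.+1 k1N (etrans (addSnnS _ _) kl).
have Fk := filtration_measurable (ltnW kN).
have compoundE : compound k.+1 N = (1 + rate M k.+1) * compound k.+2 N.
  by rewrite /compound big_ltn.
split.
  have Pkg g : {ae P, forall w,
      Pa k w g ord0 = - (compound k.+1 N * reward M g)}.
    have Pkg := Pk k k1N g ord0; apply: (cond_exp_ae_unique Fk Pkg).
    apply: (cond_exp_ae_congr Fk _ _ (cond_exp_cst P _ _)); last by case: Pkg.
    by apply: filterS Pih => w Pw; rewrite mxE Pw !mxE compoundE; ring.
  apply: filterS (filter_forall _ Pkg) => w Pw.
  by apply/matrixP => g j; rewrite (ord1 j) Pw !mxE.
have Qkgj (gj : 'I_2 * 'I_d) : {ae P, forall w, Qa k w gj.1 gj.2 = 0}.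
  have Qkgj := Qk k k1N gj.1 gj.2; apply: (cond_exp_ae_unique Fk Qkgj).
  apply: (cond_exp_ae_congr Fk _ _
    (noise0 k (- (compound k.+1 N * reward M gj.1)) gj.2 kN));
    last by case: Qkgj.
  apply: filterS Pih => w Pw; rewrite mxE [(_ *m _) _ _]mxE big_ord1 Pw !mxE.
  by rewrite compoundE; ring.
apply: filterS (filter_forall _ Qkgj) => w Qw; apply/matrixP => g j.
by rewrite (Qw (g, j)) mxE.
Qed.

(** Once the adjoint processes are known, the first-order condition is the
    definition of the candidate multiplied by the mixed weight. *)
Lemma stationarity (theta : R) k : 0 <= theta <= 1 -> (k < N)%N ->
  {ae P, forall w,
  excess_mx M k w *m theta_mx theta *m Pa k w
  + \sum_(j < d) volatility_mx M j k w *m theta_mx theta *m col j (Qa k w)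
  + weight_mix M theta k w *: (candidate theta k w - benchmark M k w) = 0}.
Proof.
move=> t01 kN; have [PE QE] := adjoint_solution kN.
have [c c0 Wc] := weight_mix_lower_bound kN.
apply: filterS3 PE QE Wc => w -> -> /(_ _ t01) Wc.
have W0 : weight_mix M theta k w != 0 by rewrite gt_eqF// (lt_le_trans c0).
rewrite big1 => [|j _]; last by rewrite col0 mulmx0.
have -> : candidate theta k w - benchmark M k w = (weight_mix M theta k w)^-1 *:
    (compound k.+1 N *: (excess_mx M k w *m theta_mx theta *m reward_vec M)).
  by rewrite /candidate addrAC subrr add0r.
rewrite addr0 scalerA divff// scale1r.
by rewrite mulmxN -scalemxAr addNr.
Qed.

End model.

(** * The optimal robust portfolio *)

Theorem theorem4p1 (dT : measure_display) (T : measurableType dT)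
    (R : realType) (P : probability T R) (m d N : nat)
    (B : nat -> T -> 'cV[R]_d) (p C q : R) (M : market T R m d)
    (Pa : nat -> T -> 'cV[R]_2) (Qa : nat -> T -> 'M[R]_(2, d))
    (N_gt0 : (0 < N)%N)
    (P_complete : measure_is_complete P)
    (* the noise *)
    (B_meas : forall k, (0 < k <= N)%N -> mx_measurable (B k))
    (B_indep : independent_vectors P N B)
    (p_ge2 : 2 <= p)
    (B_moment : forall k, (0 < k <= N)%N ->
      ('E_P[fun w => (enorm (B k w) `^ p)%R] <= C%:E)%E)
    (B_mean : forall (k : nat) (j : 'I_d), (k < N)%N ->
      cond_exp P (filtration B k) (fun w => B k.+1 w j ord0) (fun _ => 0))
    (B_var : forall (k : nat) (j : 'I_d), (k < N)%N ->
      cond_exp P (filtration B k) (fun w => B k.+1 w j ord0 ^+ 2) (fun _ => 1))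
    (* the control exponent *)
    (q_gt2 : 2 < q)
    (* the market *)
    (rate_gt0 : forall k, (k < N)%N -> 0 < rate M k)
    (rate_bounded : exists b : R, forall k, (k < N)%N -> rate M k <= b)
    (appreciation_meas : forall g k, (k < N)%N ->
      mx_measurable_wrt (filtration B k) (appreciation M g k))
    (appreciation_bounded : forall g k, (k < N)%N ->
      bounded_rvec P (appreciation M g k))
    (volatility_meas : forall g j k, (k < N)%N ->
      mx_measurable_wrt (filtration B k) (volatility M g j k))
    (volatility_bounded : forall g j k, (k < N)%N ->
      bounded_rvec P (volatility M g j k))
    (benchmark_meas : forall k, (k < N)%N ->
      mx_measurable_wrt (filtration B k) (benchmark M k))
    (benchmark_bounded : forall k, (k < N)%N -> bounded_rvec P (benchmark M k))
    (weight_meas : forall g k, (k < N)%N ->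
      measurable_wrt (filtration B k) (weight M g k))
    (weight_bounded : forall g k, (k < N)%N -> bounded_rv P (weight M g k))
    (weight_gg0 : forall g k, (k < N)%N ->
      exists c : R, 0 < c /\ {ae P, forall w, c <= weight M g k w})
    (reward_gt0 : forall g, 0 < reward M g)
    (wealth0_gt0 : 0 < wealth0 M)
    (* the adjoint processes *)
    (PQ_adjoint : adjoint_processes P N M B Pa Qa) :
  exists (theta : R) (u : nat -> T -> 'cV[R]_m),
    [/\ 0 <= theta <= 1,
        admissible P N B q u,
        [/\ robust_cost P N M B u
              = ereal_sup [set mix t (cost P N M B u) |
                           t in [set t : R | 0 <= t <= 1]],
            ereal_sup [set mix t (cost P N M B u) |
                       t in [set t : R | 0 <= t <= 1]]
              = maxe (cost P N M B u gamma1) (cost P N M B u gamma2) &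
            maxe (cost P N M B u gamma1) (cost P N M B u gamma2)
              = mix theta (cost P N M B u)],
        (forall k, (k < N)%N -> {ae P, forall w,
           excess_mx M k w *m theta_mx theta *m Pa k w
           + \sum_(j < d) volatility_mx M j k w *m theta_mx theta
                            *m col j (Qa k w)
           + weight_mix M theta k w *: (u k w - benchmark M k w) = 0}) &
        (forall k w, (k < N)%N ->
           u k w = benchmark M k w
             + (weight_mix M theta k w)^-1 *:
               ((\prod_(k.+1 <= i < N) (1 + rate M i)) *:
                (excess_mx M k w *m theta_mx theta *m reward_vec M)))
        /\ (forall v, admissible P N B q v ->
              (robust_cost P N M B u <= robust_cost P N M B v)%E)].
Proof.
have q_ge0 : 0 <= q by rewrite ltW// (lt_trans _ q_gt2).
have L2 v : admissible P N B q v -> L2_control P N B v.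
  by apply: admissible_L2.
have candL2 t : 0 <= t <= 1 -> L2_control P N B (candidate N M t).
  by move=> t01; apply: candidate_L2.
have costL2 v : L2_control P N B v ->
    cost P N M B v = (fun g => (mean_cost P N M v g)%:E).
  by move=> vL2; apply/funext => g; apply: costE.
have robustL2 v : L2_control P N B v -> robust_cost P N M B v =
    ereal_sup [set mix t (cost P N M B v) | t in [set t : R | 0 <= t <= 1]].
  by move=> vL2; rewrite /robust_cost costL2// priors_image.
have [K1 lip1] : exists K,
    lip01 (fun t => mean_cost P N M (candidate N M t) gamma1) K.
  by apply: (mean_cost_lip01 (B := B)).
have [K2 lip2] : exists K,
    lip01 (fun t => mean_cost P N M (candidate N M t) gamma2) K.
  by apply: (mean_cost_lip01 (B := B)).
(* The worst-case mixture for the candidate that is optimal for this mixture. *)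
have [theta t01 saddle] := saddle_parameter lip1 lip2.
pose u := candidate N M theta.
have uL2 : L2_control P N B u by exact: candL2.
have saddleE : maxe (cost P N M B u gamma1) (cost P N M B u gamma2) =
    mix theta (cost P N M B u).
  by rewrite costL2// -EFin_max saddle.
have supE : ereal_sup [set mix t (cost P N M B u) |
    t in [set t : R | 0 <= t <= 1]] =
    maxe (cost P N M B u gamma1) (cost P N M B u gamma2).
  by rewrite costL2// ereal_sup_mix.
exists theta, u; split=> //.
- by apply: candidate_admissible.
- by split=> //; exact: robustL2.
- by move=> k kN; exact: (stationarity B_meas B_mean weight_gg0 PQ_adjoint t01).
split=> [//|v /L2 vL2].
rewrite robustL2// supE saddleE robustL2//.
apply: (@le_trans _ _ (mix theta (cost P N M B v))); last first.
  by apply: ereal_sup_ubound; exists theta.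
by rewrite !costL2// lee_fin; apply: (candidate_minimizes (B := B)).
Qed.
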